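(* Let $T$ be a tree and $\theta$ a real number. Then $T$ is $\theta$-super positive if and only if $\theta=0$ and $T$ has a perfect matching.
   Context: All graphs are finite and simple. For a graph $G$ on $n$ vertices, $p(G,r)$ is the number of $r$-matchings in $G$ ($p(G,0)=1$) and $\mu(G,x)=\sum_{r=0}^{\lfloor n/2\rfloor}(-1)^r p(G,r)x^{n-2r}$ is its matching polynomial (the empty graph has $\mu=1$). $G\setminus v$ denotes deletion of vertex $v$. $G$ is $\theta$-super positive if $\mu(G,\theta)\neq 0$ and $\mu(G\setminus v,\theta)=0$ for every $v\in V(G)$. *)

(* Defs.v *)
From HB Require Import structures.
From mathcomp Require Import all_boot all_order all_algebra.
From mathcomp Require Import reals.

Set Implicit Arguments.
Unset Strict Implicit.
Unset Printing Implicit Defensive.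

Import GRing.Theory.
Local Open Scope ring_scope.

Record sgraph := SGraph {
  vertex :> finType;
  adj : rel vertex;
  adj_sym : symmetric adj;
  adj_irrefl : irreflexive adj
}.

Definition edges (G : sgraph) : {set {set G}} :=
  [set [set p.1; p.2] | p : G * G & adj p.1 p.2].

Definition is_matching (G : sgraph) (M : {set {set G}}) : bool :=
  (M \subset edges G) && trivIset M.

Definition num_matchings (G : sgraph) (r : nat) : nat :=
  #|[set M : {set {set G}} | is_matching M & #|M| == r]|.

Definition has_perfect_matching (G : sgraph) : Prop :=
  exists2 M : {set {set G}}, is_matching M & cover M = [set: G].

Definition matching_poly (R : nzRingType) (G : sgraph) : {poly R} :=
  \sum_(0 <= r < (#|G|./2).+1)
    ((-1) ^+ r * (num_matchings G r)%:R) *: 'X^(#|G| - r.*2).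

Section DeleteVertex.
Variables (G : sgraph) (v : G).

Definition del_adj : rel {u : G | u != v} := fun x y => adj (val x) (val y).

Fact del_adj_sym : symmetric del_adj.
Proof. by move=> x y; apply: adj_sym. Qed.

Fact del_adj_irrefl : irreflexive del_adj.
Proof. by move=> x; apply: adj_irrefl. Qed.

Definition del_vertex : sgraph := SGraph del_adj_sym del_adj_irrefl.
End DeleteVertex.

Definition super_positive (R : nzRingType) (theta : R) (G : sgraph) : Prop :=
  (matching_poly R G).[theta] != 0 /\
  forall v : G, (matching_poly R (del_vertex v)).[theta] = 0.

Definition is_connected (G : sgraph) : Prop :=
  forall x y : G, connect (@adj G) x y.

(* [ucycle] also holds of [::] and of [:: x; y] with x and y adjacent, so a
   graph-theoretic cycle is a [ucycle] of size at least 3. *)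
Definition is_acyclic (G : sgraph) : Prop :=
  forall c : seq G, ucycle (@adj G) c -> (size c < 3)%N.

(* The empty graph is not a tree: it is vacuously theta-super positive for
   every theta. *)
Definition is_tree (G : sgraph) : Prop :=
  [/\ (0 < #|G|)%N, is_connected G & is_acyclic G].

(* Main.v *)
(** If [v] is isolated then [mu(G,theta) = theta * mu(G\v,theta)], so a
    super-positive graph has no isolated vertex.  If [v] is a leaf with
    neighbour [u], then [mu(G) = theta mu(G\v) - mu(G\v\u)] and
    [mu(G\u) = theta mu(G\u\v)]; super-positivity makes [mu(G\v\u)] nonzero and
    [theta mu(G\u\v)] zero, whence [theta = 0].  At [theta = 0] only perfect
    matchings contribute, all with the same sign, and none exists in [G\v] by
    parity. *)
Require Import Defs.
From HB Require Import structures.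
From mathcomp Require Import all_boot all_order all_algebra.
From mathcomp Require Import reals.

Local Open Scope ring_scope.
Import GRing.Theory Num.Theory.

Set Implicit Arguments.
Unset Strict Implicit.
Unset Printing Implicit Defensive.

(** * Matchings and the vertices they cover *)

Section Matchings.
Variable G : sgraph.
Implicit Types (e A : {set G}) (M : {set {set G}}).

Lemma edgesP e :
  reflect (exists x y, adj x y /\ e = [set x; y]) (e \in edges G).
Proof.
apply: (iffP imsetP) => [[[x y] Hxy ->]|[x [y [Hxy ->]]]].
  by exists x, y; rewrite inE in Hxy.
by exists (x, y); rewrite ?inE.
Qed.

Lemma card_edge e : e \in edges G -> #|e| = 2%N.
Proof.
case/edgesP=> x [y [Hxy ->]]; rewrite cards2.
by case: eqVneq Hxy => // ->; rewrite adj_irrefl.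
Qed.

Lemma matching_edge M e : is_matching M -> e \in M -> e \in edges G.
Proof. by case/andP=> /subsetP sM _ /sM. Qed.

Lemma card_cover_matching M : is_matching M -> #|cover M| = (#|M|.*2)%N.
Proof.
move=> mM; case/andP: (mM) => _ /eqP <-.
rewrite (eq_bigr (fun _ => 2%N)) => [|e /(matching_edge mM)/card_edge //].
by rewrite sum_nat_const muln2.
Qed.

Lemma matching_coverP M v : is_matching M -> v \in cover M ->
  exists2 u, adj v u & [set v; u] \in M.
Proof.
move=> mM /bigcupP[e eM]; case/edgesP: (matching_edge mM eM) => x [y [Hxy De]].
rewrite De in eM *; rewrite !inE => /orP[] /eqP ->; first by exists y.
by exists x; rewrite 1?adj_sym // setUC.
Qed.

Lemma is_matchingU1 M e : e \notin M -> is_matching (e |: M) =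
  [&& e \in edges G, is_matching M & [disjoint e & cover M]].
Proof.
move=> eM; rewrite /is_matching subUset sub1set -!andbA; congr (_ && _).
case: (boolP (M \subset edges G)) => //= sM.
apply/idP/andP=> [tM|[tM dM]].
  split; first by apply: trivIsetS tM; apply: subsetUr.
  apply/bigcup_disjointP => f fM.
  apply: (trivIsetP tM); rewrite ?setU11 ?setU1r //.
  by apply: contraNneq eM => ->.
have {}dM f : f \in M -> [disjoint e & f] by move/bigcup_disjointP: dM; apply.
apply/trivIsetP=> f g /setU1P[->|fM] /setU1P[->|gM]; rewrite ?eqxx //.
- by move=> _; exact: dM.
- by rewrite disjoint_sym => _; exact: dM.
- exact: (trivIsetP tM).
Qed.

Lemma cover_setU1 M e : cover (e |: M) = e :|: cover M.
Proof. by rewrite /cover bigcup_setU big_set1. Qed.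

End Matchings.

(** * Recurrences for the matching polynomial at a point *)

Section MatchingSum.
Variables (R : nzRingType) (theta : R).

(* The value at [theta] of the matching polynomial of the subgraph induced on
   [A]; working with subsets avoids iterated vertex-deletion subtypes. *)
Definition matching_sum (G : sgraph) (A : {set G}) : R :=
  \sum_(M | is_matching M && (cover M \subset A))
    (-1) ^+ #|M| * theta ^+ (#|A| - #|M|.*2).

Lemma horner_matching_poly (G : sgraph) :
  (matching_poly R G).[theta] = matching_sum [set: G].
Proof.
rewrite /matching_poly /matching_sum horner_sum big_mkord.
have lt_half (M : {set {set G}}) : is_matching M -> (#|M| < #|G|./2.+1)%N.
  move=> mM; rewrite ltnS -[#|M|]doubleK -card_cover_matching //.
  by apply: half_leq; apply: max_card.
(* Matchings are grouped by size; [lt_half] keeps [inord] from falling back to its default value. *)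
rewrite [RHS](partition_big
  (fun M : {set {set G}} => inord #|M| : 'I_(#|G|./2.+1)) xpredT) //=.
apply: eq_bigr => r _; rewrite hornerZ hornerXn.
rewrite (eq_bigl [in [set M : {set {set G}} | is_matching M & #|M| == r]]).
  rewrite (eq_bigr (fun=> (-1) ^+ r * theta ^+ (#|G| - r.*2))).
    by rewrite sumr_const -[RHS]mulr_natl mulrA commr_nat.
  by move=> M; rewrite /= inE cardsT => /andP [_ /eqP ->].
move=> M; rewrite /= inE subsetT andbT; case: (boolP (is_matching M)) => //= mM.
by rewrite -val_eqE /= inordK ?lt_half.
Qed.

(** A matching inside [A :\ v] has [#|M|.*2 < #|A|], so the truncated subtraction is exact and one
    factor [theta] can be pulled out. *)
Lemma matching_sum_avoid (G : sgraph) (A : {set G}) v : v \in A ->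
  \sum_(M | is_matching M && (cover M \subset A :\ v))
    (-1) ^+ #|M| * theta ^+ (#|A| - #|M|.*2) = theta * matching_sum (A :\ v).
Proof.
move=> vA; rewrite /matching_sum big_distrr /=.
apply: eq_bigr => M /andP[mM /subset_leq_card].
rewrite card_cover_matching // => leM.
by rewrite (cardsD1 v A) vA add1n subSn // exprS !mulrA commr_sign.
Qed.

Lemma matching_sum_isolated (G : sgraph) (A : {set G}) v :
    v \in A -> (forall u, u \in A -> ~~ adj v u) ->
  matching_sum A = theta * matching_sum (A :\ v).
Proof.
move=> vA isov; rewrite -matching_sum_avoid //; apply: eq_bigl => M.
case: (boolP (is_matching M)) => //= mM; rewrite subsetD1.
case: (boolP (cover M \subset A)) => //= /subsetP sMA; apply/esym.
apply/negP=> /(matching_coverP mM)[u vu vuM]; apply/negP: vu; apply: isov.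
by apply: sMA; apply/bigcupP; exists [set v; u]; rewrite ?set22.
Qed.

(** Matchings without the edge [e] miss [v], since [e] is the only edge at [v] inside [A]. Those
    with [e] become matchings of [A :\ v :\ u] once [e] is removed, which flips the sign. *)
Lemma matching_sum_leaf (G : sgraph) (A : {set G}) v u :
    v \in A -> u \in A -> adj v u -> (forall w, w \in A -> adj v w -> w = u) ->
  matching_sum A = theta * matching_sum (A :\ v) - matching_sum (A :\ v :\ u).
Proof.
move=> vA uA vu leafv; set e := [set v; u].
have e_edge : e \in edges G by apply/edgesP; exists v, u.
have uAv : u \in A :\ v.
  by rewrite !inE uA andbT; apply: contraTneq vu => ->; rewrite adj_irrefl.
have De : A :\ v :\ u = A :\: e by rewrite setDDl.
have sub_cover f (M : {set {set G}}) : f \in M -> f \subset cover M.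
  by move=> fM; apply: (bigcup_sup f).
rewrite {1}/matching_sum (bigID (fun M : {set {set G}} => e \notin M)) /=.
congr (_ + _).
  rewrite -matching_sum_avoid //; apply: eq_bigl => M.
  case: (boolP (is_matching M)) => //= mM; rewrite subsetD1.
  case: (boolP (cover M \subset A)) => //= /subsetP sMA; congr (~~ _).
  apply/idP/idP => [/sub_cover/subsetP-> //|]; first by rewrite set21.
  case/(matching_coverP mM)=> w vw vwM; rewrite /e -(leafv w) //.
  by apply/sMA/(subsetP (sub_cover _ _ vwM)); rewrite set22.
rewrite (reindex_onto (fun M => e |: M) (fun M => M :\ e)) /=; last first.
  by move=> M /andP[_]; rewrite negbK; apply: setD1K.
rewrite /matching_sum De -sumrN.
have eP (M : {set {set G}}) : ((e |: M) :\ e == M) = (e \notin M).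
  by apply/eqP/idP => [<-|]; [rewrite setD11|exact: setU1K].
apply: eq_big => M.
  (* If [e] already lies in [M], adding and removing it does not give back [M]; the right-hand side
     omits such [M] too, as they cover [v]. *)
  rewrite eP setU11 andbT; case: (boolP (e \in M)) => [eM|eM].
    rewrite andbF; apply/esym/negP=> /andP[_]; rewrite subsetD => /andP[_].
    move/disjoint_setI0/setP/(_ v); rewrite !inE eqxx /= andbT.
    by rewrite (subsetP (sub_cover _ _ eM)) // set21.
  rewrite andbT is_matchingU1 // e_edge /= cover_setU1 subUset subsetD.
  rewrite -andbA disjoint_sym; congr (_ && _).
  have -> : e \subset A by rewrite subUset !sub1set vA.
  by rewrite andbC.
rewrite eP => /andP[_ eM].
rewrite cardsU1 eM add1n exprS mulN1r mulNr.
by rewrite (cardsD1 v A) vA (cardsD1 u (A :\ v)) uAv De !add1n.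
Qed.

(** Taking images under [val] is a size-preserving bijection from matchings of the subtype graph to
    matchings of [G] avoiding [v]. *)
Lemma matching_sum_del_vertex (G : sgraph) (v : G) :
  matching_sum [set: del_vertex v] = matching_sum [set~ v].
Proof.
pose f (e : {set del_vertex v}) : {set G} := val @: e.
pose g (e : {set G}) : {set del_vertex v} := val @^-1: e.
have val_im e u : (val u \in f e) = (u \in e) by exact: mem_imset val_inj.
have fK : cancel f g by move=> e; apply/setP=> u; rewrite inE val_im.
have gK (e : {set G}) : e \subset [set~ v] -> f (g e) = e.
  move=> /subsetP sev; apply/setP=> u; apply/imsetP/idP => [[w] |ue].
    by rewrite inE => we ->.
  have uv : u != v by have := sev u ue; rewrite !inE.
  by exists (Sub u uv); rewrite ?inE SubK.
have f_inj := can_inj fK.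
have f_edge e : (f e \in edges G) = (e \in edges (del_vertex v)).
  apply/edgesP/edgesP=> [[x [y [xy Dfe]]]|[x [y [xy ->]]]]; last first.
    by exists (val x), (val y); rewrite /f imsetU !imset_set1.
  have /imsetP[x' _ Dx] : x \in f e by rewrite Dfe set21.
  have /imsetP[y' _ Dy] : y \in f e by rewrite Dfe set22.
  exists x', y'; split; first by rewrite /= /del_adj -Dx -Dy.
  by apply: f_inj; rewrite Dfe Dx Dy /f imsetU !imset_set1.
have f_disj e1 e2 : [disjoint f e1 & f e2] = [disjoint e1 & e2].
  exact/imset_disjoint/val_inj.
have f_matching (M : {set {set del_vertex v}}) :
    is_matching (f @: M) = is_matching M.
  congr (_ && _).
    apply/subsetP/subsetP=> [sM e eM|sM _ /imsetP[e /sM eM ->]].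
      by rewrite -f_edge; apply/sM/imset_f.
    by rewrite f_edge.
  apply/trivIsetP/trivIsetP => [tM e1 e2 M1 M2 ne|tM].
    by rewrite -f_disj; apply: tM; rewrite ?imset_f // inj_eq.
  move=> _ _ /imsetP[e1 M1 ->] /imsetP[e2 M2 ->]; rewrite inj_eq // f_disj.
  exact: tM.
have imfK : cancel (fun M : {set {set del_vertex v}} => f @: M)
                   (fun M : {set {set G}} => g @: M).
  by move=> M /=; rewrite -imset_comp (eq_imset _ fK) imset_id.
have f_sub e : f e \subset [set~ v].
  by apply/subsetP=> _ /imsetP[u _ ->]; rewrite !inE (valP u).
rewrite /matching_sum [RHS](reindex_onto
  (fun M : {set {set del_vertex v}} => f @: M)
  (fun M : {set {set G}} => g @: M)) /=; last first.
  move=> M /andP[_ /bigcupsP sM]; rewrite -imset_comp -[RHS]imset_id.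
  by apply: eq_in_imset => e /sM/gK.
apply: eq_big => M.
  rewrite f_matching imfK eqxx subsetT !andbT; apply/esym/andb_idr => _.
  by apply/bigcupsP=> _ /imsetP[e _ ->].
rewrite card_imset // cardsT card_sig => _; congr (_ * _ ^+ (_ - _)%N).
by apply: eq_card => u; rewrite !inE.
Qed.
End MatchingSum.

(** * A vertex of degree at most one *)

(** An end of a non-extendable path serves as [v]. Adjacency of [v] and [u] is not claimed, so an
    isolated [v] is allowed. *)
Lemma acyclic_degree_le1 (G : sgraph) : (0 < #|G|)%N -> is_acyclic G ->
  exists v u : G, forall w, adj v w -> w = u.
Proof.
move=> /card_gt0P[x0 _] acG.
(* All neighbours of the end [x] of a path that cannot be prolonged lie on the
   path, and a neighbour other than the next vertex would close a cycle. *)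
have maxpath (x : G) p : path (@adj G) x p -> uniq (x :: p) ->
    (forall w, ~~ (adj x w && (w \notin x :: p))) ->
    exists v u : G, forall w, adj v w -> w = u.
  (* For empty [p] the default [x] is harmless: [x] then has no neighbour. *)
  move=> px up maxp; exists x, (head x p) => w xw.
  have := maxp w; rewrite xw negbK inE => /orP[/eqP wx|wp].
    by rewrite wx adj_irrefl in xw.
  case/splitPr: wp px up => p1 p2.
  rewrite -cat_rcons -cat_cons cat_path cat_uniq.
  case: p1 => [|y p1] // /andP[px1 _] /andP[up1 _].
  have /acG : ucycle (@adj G) (x :: rcons (y :: p1) w).
    by rewrite /ucycle up1 /cycle rcons_path px1 last_rcons adj_sym xw.
  by rewrite /= size_rcons.
(* Prolong the path greedily at its front; [n] bounds the number of vertices off the path. *)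
suff ext n (x : G) p : path (@adj G) x p -> uniq (x :: p) ->
    (#|G| - size (x :: p) <= n)%N ->
    exists v u : G, forall w, adj v w -> w = u.
  exact: (ext #|G| x0 [::] isT isT (leq_subr _ _)).
elim: n x p => [|n IHn] x p px up szp;
  (have [/existsP[w /andP[xw wp]]|/existsPn maxp] :=
     boolP [exists w, adj x w && (w \notin x :: p)]); first 1 last.
- exact: (maxpath x p).
- apply: (IHn w (x :: p)); rewrite ?cons_uniq ?wp //=.
    by rewrite adj_sym xw.
  by rewrite subnS -subn1 leq_subLR add1n.
- exact: (maxpath x p).
(* Remaining case [n = 0]: the path exhausts [G], leaving no room for [w]. *)
have uw : uniq (w :: x :: p) by rewrite cons_uniq wp.
have := max_card (mem (w :: x :: p)); rewrite (card_uniqP uw) /=.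
by rewrite leqNgt ltnS -subn_eq0 -leqn0 szp.
Qed.

(** * Perfect matchings and the characterization *)

(** The number tested is the exponent of [theta] in the term of [M], so at [theta = 0] exactly the
    perfect matchings survive. *)
Lemma perfect_matchingP (G : sgraph) (M : {set {set G}}) : is_matching M ->
  reflect (cover M = [set: G]) (#|G| - #|M|.*2 == 0)%N.
Proof.
move=> mM; rewrite -card_cover_matching // subn_eq0 -cardsT.
by apply: (iffP idP) => [leM|-> //]; apply/eqP; rewrite eqEcard subsetT.
Qed.

Theorem theorem2p4 (R : realType) (T : sgraph) (hT : is_tree T) (theta : R) :
  super_positive theta T <-> (theta = 0 /\ has_perfect_matching T).
Proof.
split=> [[]|[-> [M0 mM0 cM0]]].
- rewrite horner_matching_poly => Tnz Tdel.
  have {}Tdel (v : T) : matching_sum theta [set~ v] = 0.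
    by rewrite -matching_sum_del_vertex -horner_matching_poly.
  have theta0 : theta = 0.
    have [T_gt0 _ acT] := hT; have [v [u leafv]] := acyclic_degree_le1 T_gt0 acT.
    have [vu|nvu] := boolP (adj v u); last first.
      case/eqP: Tnz; rewrite (@matching_sum_isolated _ _ _ _ v) //.
        by rewrite setTD Tdel mulr0.
      by move=> w _; apply: contra nvu => vw; rewrite -(leafv w vw).
    have uv : u != v by apply: contraTneq vu => ->; rewrite adj_irrefl.
    have := Tdel u; rewrite (@matching_sum_isolated _ _ _ _ v).
    + have -> : [set~ u] :\ v = [set: T] :\ v :\ u.
        by apply/setP=> w; rewrite !inE andbT andbC.
      move/eqP; rewrite mulf_eq0 => /orP[/eqP//|/eqP Tvu0].
      case/eqP: Tnz; rewrite (@matching_sum_leaf _ _ _ _ v u) // => [|w _].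
        by rewrite Tvu0 setTD Tdel mulr0 subr0.
      exact: leafv.
    + by rewrite !inE eq_sym.
    + by move=> w; rewrite !inE; apply: contraNN => /leafv ->.
  split=> //; rewrite theta0 in Tnz.
  have [|/existsPn nM] := boolP [exists M : {set {set T}},
      is_matching M && (#|T| - #|M|.*2 == 0)%N].
    by case/existsP=> M /andP[mM /(perfect_matchingP mM)]; exists M.
  case/eqP: Tnz; apply: big1 => M /andP[mM _]; have := nM M.
  by rewrite mM /= cardsT expr0n => /negPf->; rewrite mulr0.
have cardT : #|T| = (#|M0|.*2)%N by rewrite -cardsT -cM0 card_cover_matching.
split=> [|v]; rewrite horner_matching_poly.
  (* All perfect matchings have size [#|M0|], so the sum is a sign times their number, which is
     positive because of [M0]. *)
  rewrite /matching_sum (eq_bigr (fun M : {set {set T}} =>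
    (-1) ^+ #|M0| * (cover M == setT)%:R)) => [|M /andP[mM _]].
    rewrite -big_distrr /= mulf_neq0 ?signr_eq0 // -natr_sum pnatr_eq0.
    by rewrite (bigD1 M0) ?mM0 ?subsetT //= cM0 eqxx.
  rewrite expr0n cardsT; case: (perfect_matchingP mM) => cM.
    rewrite cM eqxx; congr ((-1) ^+ _ * _); apply: double_inj.
    by rewrite -cardT -card_cover_matching // cM cardsT.
  by rewrite (introF eqP cM) !mulr0.
have T_gt0 : (0 < #|T|)%N by apply/card_gt0P; exists v.
rewrite matching_sum_del_vertex; apply: big1 => M /andP[mM].
move/subset_leq_card; rewrite card_cover_matching // cardsC1 => leM.
rewrite expr0n subn_eq0.
case: leqP => [geM|_]; last by rewrite mulr0.
(* A zero exponent would make [#|T|.-1] even, but [#|T|] is itself even and positive. *)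
have De : (#|M|.*2)%N = #|T|.-1 by apply/eqP; rewrite eqn_leq leM.
by have := congr1 odd (prednK T_gt0); rewrite -De cardT /= !odd_double.
Qed.
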